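(* Let $N$ be a positive integer, let $c\in\mathbb{C}$ with $c\neq q^{-n}$ for all positive integers $n$, and let $|t|<1$, $|q|<1$. Then \[ \sum_{n=0}^{\infty}c^n \left[ \frac{(t)_n}{(t)_{N+n}} - 1 \right] = \sum_{n=1}^{\infty}\frac{(q^N)_n\,t^n}{(q)_{n}(1-cq^n)}. \]
   Context: For $x\in\mathbb{C}$ and $n\ge 0$, $(x)_n=(x;q)_n=\prod_{j=0}^{n-1}(1-xq^j)$, with $(x)_0=1$.
   Formalization: The left-hand series diverges when |cq| ≥ 1 and t, q ≠ 0, so equality is asserted whenever that series converges (proved for |cq| < 1); for every admissible c the right-hand series is shown to converge and to be complex differentiable in c; for q = 0 no c is excluded. *)

(* Defs.v *)
From Stdlib Require Import Reals.
From Coquelicot Require Import Coquelicot.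

Open Scope C_scope.

(* (x; q)_n = (1 - x) (1 - x q) ... (1 - x q^(n-1)) *)
Fixpoint qpoch (x q : C) (n : nat) : C :=
  match n with
  | O => 1
  | S m => qpoch x q m * (1 - x * q ^ m)
  end.

Definition Cex_series (a : nat -> C) : Prop := @ex_series C_AbsRing C_NormedModule a.

(* Coquelicot's [Series] is real-valued only. The value is the sum of the series
   as soon as [Cex_series a] holds, and carries no meaning otherwise. *)
Definition CSeries (a : nat -> C) : C :=
  (Series (fun n => Re (a n)), Series (fun n => Im (a n))).

Definition lhs_term (N : nat) (q t c : C) (n : nat) : C :=
  c ^ n * (qpoch t q n / qpoch t q (N + n) - 1).

Definition rhs_term (N : nat) (q t c : C) (n : nat) : C :=
  qpoch (q ^ N) q n * t ^ n / (qpoch q q n * (1 - c * q ^ n)).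

(* The right-hand series starts at n = 1, hence the shift. *)
Definition lhs_sum (N : nat) (q t c : C) : C := CSeries (lhs_term N q t c).
Definition rhs_sum (N : nat) (q t c : C) : C :=
  CSeries (fun n => rhs_term N q t c (S n)).

(* Main.v *)
(* The finite q-binomial theorem 1/(z;q)_N = sum_m A_m z^m, with
   A_m = (q^N)_m/(q)_m, at z = t q^n gives
   (t)_n/(t)_(N+n) - 1 = sum_(m>=1) A_m t^m q^(mn); summing the geometric series
   in n yields the identity for |c q| < 1.  When |c q| >= 1 the n-th term of the
   left-hand series is (c q)^n (A_1 t + O(q^n)), so convergence forces t = 0.
   On the right, the A_m are bounded and |1 - c q^m| is bounded below near any
   admissible c, so the series may be differentiated term by term. *)
Require Import Defs.
From Stdlib Require Import Reals Lra Lia.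
From Coquelicot Require Import Coquelicot.

(** * Complex series through their real and imaginary parts *)

Notation is_Cseries := (@is_series C_AbsRing C_NormedModule).

Lemma is_Cseries_ext (a b : nat -> C) (l : C) :
  (forall n, a n = b n) -> is_Cseries a l -> is_Cseries b l.
Proof. exact (is_series_ext a b l). Qed.

Lemma is_Cseries_scal_l (k : C) (a : nat -> C) (l : C) :
  is_Cseries a l -> is_Cseries (fun n => (k * a n)%C) (k * l)%C.
Proof. exact (is_series_scal_l (K := C_AbsRing) (V := C_NormedModule) k a l). Qed.

Lemma is_Cseries_minus (a b : nat -> C) (la lb : C) :
  is_Cseries a la -> is_Cseries b lb ->
  is_Cseries (fun n => (a n - b n)%C) (la - lb)%C.
Proof. exact (is_series_minus a b la lb). Qed.

Lemma is_Cseries_incr_1 (a : nat -> C) (l : C) :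
  is_Cseries a l -> is_Cseries (fun n => a (S n)) (l - a O)%C.
Proof.
  intros H. apply (is_series_incr_1 (K := C_AbsRing) (V := C_NormedModule) a).
  change (is_Cseries a (l - a O + a O)%C).
  now replace (l - a O + a O)%C with l by ring.
Qed.

(** Taking real parts commutes with partial sums and does not increase distances, so the same
    neighbourhoods serve for the real series. *)
Lemma is_Cseries_Re (a : nat -> C) (l : C) :
  is_Cseries a l -> is_series (fun n => Re (a n)) (Re l).
Proof.
  intros H. apply filterlim_locally_ball_norm. intros eps.
  generalize (proj1 (filterlim_locally_ball_norm _ _) H eps).
  apply filter_imp. intros n Hn. unfold ball_norm in *.
  match goal with |- (norm (minus ?s _) < _)%R =>
    assert (E : s = Re (sum_n a n)) end.
  { clear. induction n as [|n IH]; [now rewrite !sum_O|].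
    rewrite !sum_Sn, IH. reflexivity. }
  eapply Rle_lt_trans; [|exact Hn].
  eapply Rle_trans; [|apply (re_le_Cmod (sum_n a n - l)%C)].
  rewrite E. apply Req_le. reflexivity.
Qed.

Lemma is_Cseries_Im (a : nat -> C) (l : C) :
  is_Cseries a l -> is_series (fun n => Im (a n)) (Im l).
Proof.
  (* Multiplication by [- Ci] turns imaginary parts into real parts. *)
  intros H. apply (is_Cseries_scal_l (- Ci)), is_Cseries_Re in H.
  assert (E : forall z : C, Re (- Ci * z)%C = Im z).
  { intros z. unfold Re, Im; simpl. ring. }
  rewrite E in H. revert H. apply is_series_ext. intros n. apply E.
Qed.

Lemma CSeries_unique (a : nat -> C) (l : C) : is_Cseries a l -> CSeries a = l.
Proof.
  intros H. unfold CSeries.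
  rewrite (is_series_unique _ _ (is_Cseries_Re _ _ H)).
  rewrite (is_series_unique _ _ (is_Cseries_Im _ _ H)).
  now destruct l.
Qed.

Lemma CSeries_correct (a : nat -> C) : Cex_series a -> is_Cseries a (CSeries a).
Proof. intros [l Hl]. now rewrite (CSeries_unique _ _ Hl). Qed.

Lemma Cex_series_le (a : nat -> C) (b : nat -> R) :
  (forall n, (Cmod (a n) <= b n)%R) -> ex_series b -> Cex_series a.
Proof. exact (@ex_series_le C_AbsRing C_CompleteNormedModule a b). Qed.

Lemma is_Cseries_Cmod_le (a : nat -> C) (b : nat -> R) (l : C) :
  (forall n, (Cmod (a n) <= b n)%R) -> ex_series b ->
  is_Cseries a l -> (Cmod l <= Series b)%R.
Proof.
  intros Hab Hb Hl.
  apply (is_lim_seq_le (fun n => Cmod (sum_n a n)) (sum_n b) (Cmod l) (Series b)).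
  - intros n. eapply Rle_trans; [exact (norm_sum_n_m a 0 n)|].
    apply sum_n_m_le. exact Hab.
  - eapply filterlim_comp; [exact Hl|].
    exact (filterlim_norm (K := C_AbsRing) (V := C_NormedModule) l).
  - exact (Series_correct _ Hb).
Qed.

Lemma is_Cseries_lim_0 (a : nat -> C) :
  Cex_series a -> is_lim_seq (fun n => Cmod (a n)) 0.
Proof.
  intros [l Hl].
  pose proof (ex_series_lim_0 _ (ex_intro _ _ (is_Cseries_Re _ _ Hl))) as HR.
  pose proof (ex_series_lim_0 _ (ex_intro _ _ (is_Cseries_Im _ _ Hl))) as HI.
  apply is_lim_seq_abs_0 in HR. apply is_lim_seq_abs_0 in HI.
  apply (is_lim_seq_le_le (fun _ => 0%R) _ (fun n => Rabs (Re (a n)) + Rabs (Im (a n)))%R).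
  - intros n. split; [apply Cmod_ge_0|].
    replace (a n) with (RtoC (Re (a n)) + Ci * RtoC (Im (a n)))%C at 1.
    + eapply Rle_trans; [apply Cmod_triangle|].
      rewrite Cmod_mult, Cmod_Ci, !Cmod_R. lra.
    + destruct (a n) as [x y]. unfold Cplus, Cmult, RtoC; simpl. f_equal; ring.
  - apply is_lim_seq_const.
  - replace (Finite 0) with (Finite (0 + 0)) by (f_equal; ring).
    now apply is_lim_seq_plus'.
Qed.

Lemma ex_series_scal_geom (K r : R) :
  (0 <= r < 1)%R -> ex_series (fun n => (K * r ^ n)%R).
Proof.
  intros Hr. apply (ex_series_scal_l (K := R_AbsRing) (V := R_NormedModule) K).
  apply ex_series_geom. rewrite Rabs_pos_eq; lra.
Qed.

(** * Nonvanishing and splitting of q-Pochhammer symbols *)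

Lemma Cminus_neq_0 (z : C) : (Cmod z < 1)%R -> (1 - z)%C <> 0%C.
Proof.
  intros Hz H. replace z with (RtoC 1) in Hz.
  - rewrite Cmod_1 in Hz. lra.
  - replace z with (1 - (1 - z))%C by ring. rewrite H. ring.
Qed.

Lemma Cmod_mult_pow_lt_1 (x q : C) (n : nat) :
  (Cmod x < 1)%R -> (Cmod q < 1)%R -> (Cmod (x * q ^ n) < 1)%R.
Proof.
  intros Hx Hq. rewrite Cmod_mult, Cmod_pow.
  assert (Cmod q ^ n <= 1)%R.
  { rewrite <- (pow1 n). apply pow_incr. split; [apply Cmod_ge_0|lra]. }
  assert (0 <= Cmod q ^ n)%R by (apply pow_le, Cmod_ge_0).
  pose proof (Cmod_ge_0 x). nra.
Qed.

Lemma qpoch_neq_0 (x q : C) (n : nat) :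
  (Cmod x < 1)%R -> (Cmod q < 1)%R -> qpoch x q n <> 0%C.
Proof.
  intros Hx Hq. induction n as [|n IH]; simpl.
  - exact C1_nz.
  - apply Cmult_neq_0; [exact IH|]. now apply Cminus_neq_0, Cmod_mult_pow_lt_1.
Qed.

Lemma qpoch_add (x q : C) (m n : nat) :
  qpoch x q (m + n) = (qpoch x q n * qpoch (x * q ^ n) q m)%C.
Proof.
  induction m as [|m IH]; simpl; [ring|].
  rewrite IH, Nat.add_comm, Cpow_add_r. ring.
Qed.

Lemma qpoch_S_l (x q : C) (n : nat) :
  qpoch x q (S n) = ((1 - x) * qpoch (x * q) q n)%C.
Proof.
  rewrite <- Nat.add_1_r, qpoch_add, Cpow_1_r. simpl. ring.
Qed.

(** * The q-binomial coefficients and the q-binomial theorem *)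

Definition qbinom_coef (N : nat) (q : C) (m : nat) : C :=
  (qpoch (q ^ N) q m / qpoch q q m)%C.

Lemma qbinom_coef_0_S (q : C) (m : nat) : qbinom_coef 0 q (S m) = 0%C.
Proof.
  unfold qbinom_coef. rewrite qpoch_S_l. simpl. unfold Cdiv. ring.
Qed.

(** A q-Pascal rule. After removal of the common factor [qpoch (q ^ S N) q m], it is the identity (1
    - q^(N+m+1)) - q^N (1 - q^(m+1)) = 1 - q^N. On generating functions it is multiplication by 1 -
    q^N z. *)
Lemma qbinom_coef_pascal (N : nat) (q : C) (m : nat) : (Cmod q < 1)%R ->
  qbinom_coef N q (S m)
  = (qbinom_coef (S N) q (S m) - q ^ N * qbinom_coef (S N) q m)%C.
Proof.
  intros Hq. unfold qbinom_coef.
  rewrite (qpoch_S_l (q ^ N)). simpl.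
  replace (q ^ N * q)%C with (q * q ^ N)%C by ring.
  pose proof (qpoch_neq_0 q q m Hq Hq).
  pose proof (Cminus_neq_0 _ (Cmod_mult_pow_lt_1 q q m Hq Hq)).
  field. now split.
Qed.

Lemma qbinom_coef_1 (q : C) (m : nat) : (Cmod q < 1)%R -> qbinom_coef 1 q m = 1%C.
Proof.
  intros Hq. unfold qbinom_coef. rewrite Cpow_1_r.
  field. now apply qpoch_neq_0.
Qed.

Lemma qbinom_coef_O_r (N : nat) (q : C) : qbinom_coef N q 0 = 1%C.
Proof. unfold qbinom_coef. simpl. field. Qed.

(** Induction on [N]: the Pascal rule bounds each new coefficient by r times its predecessor plus
    [K], where r = |q^N| < 1 and [K] bounds the coefficients one level below. *)
Lemma qbinom_coef_bounded (N : nat) (q : C) : (Cmod q < 1)%R ->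
  exists K : R, forall m, (Cmod (qbinom_coef N q m) <= K)%R.
Proof.
  intros Hq. destruct N as [|N].
  { exists 1%R. intros [|m].
    - rewrite qbinom_coef_O_r, Cmod_1. lra.
    - rewrite qbinom_coef_0_S, Cmod_0. lra. }
  (* The induction starts at level 1, since going from level 0 to level 1 would give the factor
     |q^0| = 1 and no contraction. *)
  induction N as [|N [K IH]].
  { exists 1%R. intros m. rewrite qbinom_coef_1, Cmod_1 by easy. lra. }
  assert (HqN : (Cmod (q ^ S N) < 1)%R) by now apply Cmod_mult_pow_lt_1.
  set (r := Cmod (q ^ S N)) in *.
  assert (Hr : (0 <= r)%R) by apply Cmod_ge_0.
  (* K / (1 - r) is the fixed point of x -> r x + K, so the bound reproduces itself along [m]. *)
  assert (HKr : (K / (1 - r) = r * (K / (1 - r)) + K)%R) by (field; lra).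
  assert (H1 : (1 <= K)%R).
  { generalize (IH 0%nat). rewrite qbinom_coef_O_r, Cmod_1. easy. }
  assert (HK1 : (0 <= K / (1 - r))%R).
  { apply Rmult_le_pos; [lra|]. apply Rlt_le, Rinv_0_lt_compat. lra. }
  exists (K / (1 - r))%R.
  induction m as [|m IHm].
  - rewrite qbinom_coef_O_r, Cmod_1. nra.
  - replace (qbinom_coef (S (S N)) q (S m))
      with (q ^ S N * qbinom_coef (S (S N)) q m + qbinom_coef (S N) q (S m))%C
      by (rewrite (qbinom_coef_pascal (S N)) by exact Hq; ring).
    eapply Rle_trans; [apply Cmod_triangle|].
    rewrite Cmod_mult. fold r. rewrite HKr.
    apply Rplus_le_compat; [|apply IH].
    now apply Rmult_le_compat_l.
Qed.

Lemma qbinom_series_dominated (N : nat) (q z : C) : (Cmod q < 1)%R ->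
  exists K : R, forall m, (Cmod (qbinom_coef N q m * z ^ m) <= K * Cmod z ^ m)%R.
Proof.
  intros Hq. destruct (qbinom_coef_bounded N q Hq) as [K H].
  exists K. intros m. rewrite Cmod_mult, Cmod_pow.
  apply Rmult_le_compat_r; [apply pow_le, Cmod_ge_0|apply H].
Qed.

(** Induction on [N]: the Pascal rule summed against z^(m+1) says that the sum at level [N] is 1 -
    q^N z times the sum at level [S N], and this is exactly the factor gained by the Pochhammer
    symbol. *)
Lemma qbinom_theorem (N : nat) (q z : C) : (Cmod q < 1)%R -> (Cmod z < 1)%R ->
  is_Cseries (fun m => (qbinom_coef N q m * z ^ m)%C) (/ qpoch z q N)%C.
Proof.
  intros Hq Hz.
  assert (Hex : forall M, Cex_series (fun m => (qbinom_coef M q m * z ^ m)%C)).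
  { intros M. destruct (qbinom_series_dominated M q z Hq) as [K HK].
    apply (Cex_series_le _ _ HK), ex_series_scal_geom.
    split; [apply Cmod_ge_0|exact Hz]. }
  assert (H1 : forall M (L : C), is_Cseries (fun m => (qbinom_coef M q m * z ^ m)%C) L ->
      is_Cseries (fun m => (qbinom_coef M q (S m) * z ^ S m)%C) (L - 1)%C).
  { intros M L HL. apply is_Cseries_incr_1 in HL.
    now rewrite qbinom_coef_O_r, Cmult_1_l in HL. }
  induction N as [|N IH].
  - pose proof (CSeries_correct _ (Hex O)) as Hl. set (l := CSeries _) in Hl.
    pose proof (H1 _ _ Hl) as H0.
    (* At level 0 all terms after the first vanish, so the tail sum equals 0 times itself and [l] is
       1. *)
    assert (E : (l - 1 = 0 * (l - 1))%C).
    { rewrite <- (CSeries_unique _ _ H0) at 1. apply CSeries_unique.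
      generalize (is_Cseries_scal_l 0 _ _ H0). apply is_Cseries_ext.
      intros m. rewrite qbinom_coef_0_S. ring. }
    replace (/ qpoch z q 0)%C with l; [exact Hl|].
    replace l with (l - 1 + 1)%C by ring. rewrite E. simpl. field.
  - pose proof (CSeries_correct _ (Hex (S N))) as Hl. set (l := CSeries _) in Hl.
    assert (E : (/ qpoch z q N - 1 = l - 1 - q ^ N * z * l)%C).
    { rewrite <- (CSeries_unique _ _ (H1 _ _ IH)). apply CSeries_unique.
      generalize (is_Cseries_minus _ _ _ _ (H1 _ _ Hl)
                    (is_Cseries_scal_l (q ^ N * z) _ _ Hl)).
      apply is_Cseries_ext. intros m.
      rewrite (qbinom_coef_pascal N), (Cpow_S z) by exact Hq. ring. }
    replace (/ qpoch z q (S N))%C with l; [exact Hl|].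
    simpl. pose proof (qpoch_neq_0 z q N Hz Hq) as Hp.
    pose proof (Cminus_neq_0 _ (Cmod_mult_pow_lt_1 z q N Hz Hq)) as Hn.
    replace (/ (qpoch z q N * (1 - z * q ^ N)))%C
      with ((/ qpoch z q N - 1 + 1) / (1 - z * q ^ N))%C by (field; now split).
    rewrite E. field. exact Hn.
Qed.

(** * Series of simple fractions: expansion, differentiation, distance to the poles *)

Lemma Cex_series_Cmod_mult_le (a b : nat -> C) (M : R) :
  ex_series (fun n => Cmod (a n)) -> (forall n, (Cmod (b n) <= M)%R) ->
  Cex_series (fun n => (a n * b n)%C).
Proof.
  intros Ha Hb. apply (Cex_series_le _ (fun n => (M * Cmod (a n))%R)).
  - intros n. rewrite Cmod_mult, Rmult_comm.
    apply Rmult_le_compat_r; [apply Cmod_ge_0|apply Hb].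
  - now apply (ex_series_scal_l (K := R_AbsRing) (V := R_NormedModule) M).
Qed.

(** The common form of the remainder estimates below: an absolutely summable sequence times a
    bounded factor. *)
Lemma is_Cseries_Cmod_mult_le (a b : nat -> C) (M : R) (l : C) :
  ex_series (fun n => Cmod (a n)) -> (forall n, (Cmod (b n) <= M)%R) ->
  is_Cseries (fun n => (a n * b n)%C) l ->
  (Cmod l <= M * Series (fun n => Cmod (a n)))%R.
Proof.
  intros Ha Hb Hl. rewrite <- Series_scal_l.
  apply (fun H1 H2 => is_Cseries_Cmod_le _ _ _ H1 H2 Hl).
  - intros n. rewrite Cmod_mult, Rmult_comm.
    apply Rmult_le_compat_r; [apply Cmod_ge_0|apply Hb].
  - now apply (ex_series_scal_l (K := R_AbsRing) (V := R_NormedModule) M).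
Qed.

Lemma Cmod_pos_neq_0 (z : C) (d : R) : (0 < d)%R -> (d <= Cmod z)%R -> z <> 0%C.
Proof. intros Hd Hz E. rewrite E, Cmod_0 in Hz. lra. Qed.

Lemma Cmod_inv_le (z : C) (d : R) :
  (0 < d)%R -> (d <= Cmod z)%R -> (Cmod (/ z) <= / d)%R.
Proof.
  intros Hd Hz. rewrite Cmod_inv by now apply (Cmod_pos_neq_0 z d).
  now apply Rinv_le_contravar.
Qed.

(* Peeling the n-th term off the tail [sum_m a_m (c w_m)^n / (1 - c w_m)] gives the
   partial sums with an explicit remainder, so no exchange of series is needed. *)
Lemma is_Cseries_geometric_expansion (a w s : nat -> C) (c : C) (r : R) :
  ex_series (fun m => Cmod (a m)) ->
  (r < 1)%R -> (forall m, (Cmod (c * w m) <= r)%R) ->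
  (forall n, is_Cseries (fun m => (a m * w m ^ n)%C) (s n)) ->
  is_Cseries (fun n => (c ^ n * s n)%C) (CSeries (fun m => (a m / (1 - c * w m))%C)).
Proof.
  intros Ha Hr Hw Hs.
  assert (Hr0 : (0 <= r)%R) by (eapply Rle_trans; [apply Cmod_ge_0|apply (Hw O)]).
  assert (Hd : forall m, (1 - r <= Cmod (1 - c * w m))%R).
  { intros m. pose proof (Cmod_triangle (1 - c * w m) (c * w m)) as T.
    replace (1 - c * w m + c * w m)%C with (RtoC 1) in T by ring.
    rewrite Cmod_1 in T. specialize (Hw m). lra. }
  assert (Hi : forall m, (Cmod (/ (1 - c * w m)) <= / (1 - r))%R).
  { intros m. apply Cmod_inv_le; [lra|apply Hd]. }
  set (R := CSeries (fun m => (a m / (1 - c * w m))%C)).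
  assert (HR : is_Cseries (fun m => (a m / (1 - c * w m))%C) R).
  { apply CSeries_correct. exact (Cex_series_Cmod_mult_le _ _ _ Ha Hi). }
  set (S' := sum_n (fun n => (c ^ n * s n)%C)).
  (* [sum_n] includes the index [K], hence the exponent [S K] in the remainder. *)
  assert (Hrem : forall K, is_Cseries
     (fun m => (a m * ((c * w m) ^ S K / (1 - c * w m)))%C) (R - S' K)%C).
  { assert (Hstep : forall K (L : C),
      is_Cseries (fun m => (a m * ((c * w m) ^ K / (1 - c * w m)))%C) L ->
      is_Cseries (fun m => (a m * ((c * w m) ^ S K / (1 - c * w m)))%C)
        (L - c ^ K * s K)%C).
    { intros K L HL.
      generalize (is_Cseries_minus _ _ _ _ HL (is_Cseries_scal_l (c ^ K) _ _ (Hs K))).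
      apply is_Cseries_ext. intros m.
      rewrite Cpow_S, Cpow_mult_l. field.
      apply (Cmod_pos_neq_0 _ (1 - r)); [lra|apply Hd]. }
    induction K as [|K IH].
    - unfold S'. rewrite sum_O. apply Hstep. revert HR. apply is_Cseries_ext.
      intros m. simpl. unfold Cdiv. ring.
    - unfold S'. rewrite sum_Sn.
      replace (R - plus (sum_n (fun n => (c ^ n * s n)%C) K) (c ^ S K * s (S K)))%C
        with (R - S' K - c ^ S K * s (S K))%C; [now apply Hstep|].
      change (R - S' K - c ^ S K * s (S K) = R - (S' K + c ^ S K * s (S K)))%C. ring. }
  set (M := Series (fun m => Cmod (a m))).
  assert (Hbound : forall K, (Cmod (R - S' K) <= r ^ S K * (/ (1 - r) * M))%R).
  { intros K. rewrite <- Rmult_assoc.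
    refine (is_Cseries_Cmod_mult_le _ _ _ _ Ha _ (Hrem K)). intros m.
    unfold Cdiv. rewrite Cmod_mult, Cmod_pow.
    apply Rmult_le_compat; [apply pow_le, Cmod_ge_0|apply Cmod_ge_0| |apply Hi].
    apply pow_incr. split; [apply Cmod_ge_0|apply Hw]. }
  assert (Hlim : is_lim_seq (fun K => r ^ S K * (/ (1 - r) * M))%R 0).
  { replace (Finite 0) with (Finite (0 * (/ (1 - r) * M))) by (f_equal; ring).
    apply is_lim_seq_mult'; [|apply is_lim_seq_const].
    apply (is_lim_seq_incr_1 (fun n => r ^ n)%R), is_lim_seq_geom.
    rewrite Rabs_pos_eq; lra. }
  apply filterlim_locally_ball_norm. intros eps.
  generalize (proj2 (is_lim_seq_spec _ _) Hlim eps). apply filter_imp.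
  intros K HK. rewrite Rminus_0_r in HK. unfold ball_norm.
  change (Cmod (S' K - R) < eps)%R.
  replace (S' K - R)%C with (- (R - S' K))%C by ring. rewrite Cmod_opp.
  eapply Rle_lt_trans; [apply Hbound|]. eapply Rle_lt_trans; [apply Rle_abs|exact HK].
Qed.

(** For each w, 1/(1 - x w) - 1/(1 - c w) - (x - c) w/(1 - c w)^2 equals (x - c)^2 w^2 / ((1 - c
    w)^2 (1 - x w)). Summed over [m], this bounds the error of the linear approximation by a
    constant times |x - c|^2. *)
Lemma is_derive_sum_simple_fractions (a w : nat -> C) (c : C) (d : R) :
  ex_series (fun m => Cmod (a m)) -> (forall m, (Cmod (w m) <= 1)%R) ->
  (0 < d)%R -> (forall m, (d <= Cmod (1 - c * w m))%R) ->
  @is_derive C_AbsRing C_NormedModule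
    (fun x => CSeries (fun m => (a m / (1 - x * w m))%C)) c
    (CSeries (fun m => (a m * (w m * (/ (1 - c * w m) * / (1 - c * w m))))%C)).
Proof.
  intros Ha Hw Hd Hc.
  set (F := fun x => CSeries (fun m => (a m / (1 - x * w m))%C)).
  set (D := CSeries _).
  (* As |w| <= 1, moving [c] by at most d/2 costs each denominator at most half of its margin
     [d]. *)
  assert (Hnear : forall x m, (Cmod (x - c) <= d / 2)%R ->
            (d / 2 <= Cmod (1 - x * w m))%R).
  { intros x m Hx. pose proof (Cmod_triangle (1 - x * w m) ((x - c) * w m)) as T.
    replace (1 - x * w m + (x - c) * w m)%C with (1 - c * w m)%C in T by ring.
    rewrite Cmod_mult in T. specialize (Hw m). specialize (Hc m).
    pose proof (Cmod_ge_0 (x - c)). pose proof (Cmod_ge_0 (w m)). nra. }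
  assert (HF : forall x, (Cmod (x - c) <= d / 2)%R ->
     is_Cseries (fun m => (a m / (1 - x * w m))%C) (F x)).
  { intros x Hx. apply CSeries_correct.
    apply (Cex_series_Cmod_mult_le _ _ (/ (d / 2)) Ha). intros m.
    apply Cmod_inv_le; [lra|now apply Hnear]. }
  assert (Hc0 : (Cmod (c - c) <= d / 2)%R).
  { replace (c - c)%C with (RtoC 0) by ring. rewrite Cmod_0. lra. }
  assert (Hic : forall m, (Cmod (/ (1 - c * w m)) <= / d)%R).
  { intros m. now apply Cmod_inv_le. }
  assert (Hid : (0 < / d)%R) by now apply Rinv_0_lt_compat.
  assert (Hid2 : (0 < / (d / 2))%R) by (apply Rinv_0_lt_compat; lra).
  assert (HD : is_Cseries
    (fun m => (a m * (w m * (/ (1 - c * w m) * / (1 - c * w m))))%C) D).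
  { apply CSeries_correct.
    apply (Cex_series_Cmod_mult_le _ _ (1 * (/ d * / d)) Ha). intros m.
    rewrite !Cmod_mult.
    repeat (apply Rmult_le_compat; [try apply Cmod_ge_0|try apply Cmod_ge_0|now auto|]);
      auto.
    apply Rmult_le_pos; apply Cmod_ge_0. }
  set (M := Series (fun m => Cmod (a m))).
  (* Two factors |w| <= 1, two inverse denominators at [c], and one at the nearby point [x]. *)
  set (B := (1 * 1 * (/ d * / d * / (d / 2)))%R).
  assert (Hquad : forall x, (Cmod (x - c) <= d / 2)%R ->
    (Cmod (F x - F c - (x - c) * D) <= Cmod (x - c) * (Cmod (x - c) * (B * M)))%R).
  { intros x Hx.
    assert (HE : is_Cseries (fun m => (a m *
        ((x - c) * (x - c) * (w m * w m *
         (/ (1 - c * w m) * / (1 - c * w m) * / (1 - x * w m)))))%C)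
        (F x - F c - (x - c) * D)%C).
    { generalize (is_Cseries_minus _ _ _ _
        (is_Cseries_minus _ _ _ _ (HF x Hx) (HF c Hc0))
        (is_Cseries_scal_l (x - c) _ _ HD)).
      apply is_Cseries_ext. intros m.
      field. split.
      - apply (Cmod_pos_neq_0 _ (d / 2)); [lra|auto].
      - apply (Cmod_pos_neq_0 _ d); auto. }
    replace (Cmod (x - c) * (Cmod (x - c) * (B * M)))%R
      with ((Cmod (x - c) * Cmod (x - c) * B) * M)%R by ring.
    refine (is_Cseries_Cmod_mult_le _ _ _ _ Ha _ HE). intros m.
    rewrite !Cmod_mult.
    assert (Hix : (Cmod (/ (1 - x * w m)) <= / (d / 2))%R).
    { apply Cmod_inv_le; [lra|auto]. }
    unfold B. pose proof (Hw m). pose proof (Hic m).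
    repeat first [ apply Rmult_le_compat | apply Rmult_le_pos
                 | apply Cmod_ge_0 | assumption | apply Rle_refl ]. }
  split; [apply is_linear_scal_l|].
  (* The remainder condition ranges over all limits of the neighbourhood filter; by separation the
     only one is [c]. *)
  intros y Hy.
  apply (is_filter_lim_locally_unique (V := AbsRing_NormedModule C_AbsRing)) in Hy.
  subst y.
  intros eps.
  assert (HBM : (0 <= B * M)%R).
  { apply Rmult_le_pos.
    - unfold B. repeat apply Rmult_le_pos; lra.
    (* [M] is nonnegative because it bounds the modulus of the sum of the zero series. *)
    - eapply Rle_trans; [apply (Cmod_ge_0 0)|].
      rewrite <- (Rmult_1_l M).
      apply (is_Cseries_Cmod_mult_le a (fun _ => 0%C) 1 0 Ha).
      + intros _. rewrite Cmod_0. lra.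
      + generalize (is_Cseries_scal_l 0 _ _ HD). rewrite Cmult_0_l.
        apply is_Cseries_ext. intros m. ring. }
  (* The first radius keeps the quadratic bound valid, the second makes |x - c| B M at most [eps];
     the added 1 avoids a division by zero. *)
  assert (Heta : (0 < Rmin (d / 2) (eps / (B * M + 1)))%R).
  { apply Rmin_pos; [lra|]. apply Rdiv_lt_0_compat; [apply eps|lra]. }
  generalize (locally_ball_norm (V := AbsRing_NormedModule C_AbsRing) c
                (mkposreal _ Heta)).
  apply filter_imp. intros x Hx.
  change (Cmod (x - c) < Rmin (d / 2) (eps / (B * M + 1)))%R in Hx.
  change (Cmod (F x - F c - (x - c) * D) <= eps * Cmod (x - c))%R.
  assert (H1 : (Cmod (x - c) <= d / 2)%R).
  { apply Rlt_le. eapply Rlt_le_trans; [exact Hx|apply Rmin_l]. }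
  assert (H2 : (Cmod (x - c) < eps / (B * M + 1))%R).
  { eapply Rlt_le_trans; [exact Hx|apply Rmin_r]. }
  eapply Rle_trans; [now apply Hquad|].
  rewrite (Rmult_comm eps). apply Rmult_le_compat_l; [apply Cmod_ge_0|].
  apply (Rmult_lt_compat_r (B * M + 1)) in H2; [|lra].
  unfold Rdiv in H2. rewrite Rmult_assoc, Rinv_l, Rmult_1_r in H2 by lra.
  pose proof (Cmod_ge_0 (x - c)). nra.
Qed.

(** Since c q^(m+1) tends to 0, all but finitely many of the moduli are at least 1/2; the remaining
    ones are positive and have a positive minimum. *)
Lemma one_minus_mult_pow_lower_bound (q c : C) :
  (Cmod q < 1)%R -> (forall m, (1 - c * q ^ S m)%C <> 0%C) ->
  exists d : R, (0 < d)%R /\ forall m, (d <= Cmod (1 - c * q ^ S m))%R.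
Proof.
  intros Hq Hc.
  assert (Hfin : forall K, exists d : R, (0 < d)%R /\
    forall m, (m < K)%nat -> (d <= Cmod (1 - c * q ^ S m))%R).
  { induction K as [|K [d [Hd IH]]].
    - exists 1%R. split; [lra|lia].
    - exists (Rmin d (Cmod (1 - c * q ^ S K))). split.
      + apply Rmin_pos; [exact Hd|]. apply Cmod_gt_0, Hc.
      + intros m Hm. destruct (Nat.eq_dec m K) as [->|Hne]; [apply Rmin_r|].
        eapply Rle_trans; [apply Rmin_l|]. apply IH. lia. }
  assert (Hlim : is_lim_seq (fun m => Cmod c * Cmod q ^ S m)%R 0).
  { replace (Finite 0) with (Finite (Cmod c * 0)) by (f_equal; ring).
    apply is_lim_seq_mult'; [apply is_lim_seq_const|].
    apply (is_lim_seq_incr_1 (fun n => Cmod q ^ n)%R), is_lim_seq_geom.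
    rewrite Rabs_pos_eq; [exact Hq|apply Cmod_ge_0]. }
  assert (Hhalf : (0 < / 2)%R) by lra.
  destruct (proj2 (is_lim_seq_spec _ _) Hlim (mkposreal _ Hhalf)) as [K HK].
  destruct (Hfin K) as [d [Hd Hlt]].
  exists (Rmin d (/ 2)). split; [now apply Rmin_pos|].
  intros m. destruct (Nat.lt_ge_cases m K) as [Hm|Hm].
  - eapply Rle_trans; [apply Rmin_l|now apply Hlt].
  - eapply Rle_trans; [apply Rmin_r|]. specialize (HK m Hm). simpl in HK.
    rewrite Rminus_0_r in HK. apply (Rle_lt_trans _ _ _ (Rle_abs _)) in HK.
    pose proof (Cmod_triangle (1 - c * q ^ S m) (c * q ^ S m)) as T.
    replace (1 - c * q ^ S m + c * q ^ S m)%C with (RtoC 1) in T by ring.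
    rewrite Cmod_1, Cmod_mult, Cmod_pow in T. simpl in T, HK |- *. lra.
Qed.

(** * Both sides in terms of the q-binomial coefficients *)

Lemma CSeries_ext (a b : nat -> C) : (forall n, a n = b n) -> CSeries a = CSeries b.
Proof.
  intros H. unfold CSeries. f_equal; apply Series_ext; intros n; now rewrite H.
Qed.

(** The cases with a zero factor hold because [/ 0] evaluates to 0. Thus [rhs_term] can be rewritten
    even where a denominator vanishes. *)
Lemma Cinv_mult_total (x y : C) : (/ (x * y) = / x * / y)%C.
Proof.
  assert (H0 : (/ 0 = 0)%C).
  { unfold Cinv, RtoC; simpl. unfold Rdiv. f_equal; ring. }
  destruct (Ceq_dec x 0) as [->|Hx].
  { rewrite Cmult_0_l, H0. ring. }
  destruct (Ceq_dec y 0) as [->|Hy].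
  { rewrite Cmult_0_r, H0. ring. }
  field. now split.
Qed.

Lemma qpoch_0_l (q : C) (n : nat) : qpoch 0 q n = 1%C.
Proof. induction n as [|n IH]; simpl; [reflexivity|]. rewrite IH. ring. Qed.

Lemma lhs_termE (N : nat) (q t c : C) (n : nat) :
  (Cmod q < 1)%R -> (Cmod t < 1)%R ->
  lhs_term N q t c n = (c ^ n * (/ qpoch (t * q ^ n) q N - 1))%C.
Proof.
  intros Hq Ht. unfold lhs_term. rewrite qpoch_add.
  pose proof (qpoch_neq_0 t q n Ht Hq).
  pose proof (qpoch_neq_0 (t * q ^ n) q N (Cmod_mult_pow_lt_1 t q n Ht Hq) Hq).
  field. now split.
Qed.

Lemma rhs_termE (N : nat) (q t c : C) (n : nat) :
  rhs_term N q t c n = (qbinom_coef N q n * t ^ n / (1 - c * q ^ n))%C.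
Proof.
  unfold rhs_term, qbinom_coef, Cdiv. rewrite Cinv_mult_total. ring.
Qed.

(** The q-binomial theorem at z = t q^n without its constant term. The powers are regrouped as
    (q^(m+1))^n so that summation over [n] becomes geometric. *)
Lemma qbinom_tail (N : nat) (q t : C) (n : nat) :
  (Cmod q < 1)%R -> (Cmod t < 1)%R ->
  is_Cseries (fun m => (qbinom_coef N q (S m) * t ^ S m * (q ^ S m) ^ n)%C)
    (/ qpoch (t * q ^ n) q N - 1)%C.
Proof.
  intros Hq Ht.
  generalize (is_Cseries_incr_1 _ _
    (qbinom_theorem N q (t * q ^ n) Hq (Cmod_mult_pow_lt_1 t q n Ht Hq))).
  rewrite qbinom_coef_O_r.
  replace (1 * (t * q ^ n) ^ 0)%C with (RtoC 1) by (simpl; ring).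
  apply is_Cseries_ext. intros m.
  rewrite Cpow_mult_l, <- !Cpow_mult_r, (Nat.mul_comm n). ring.
Qed.

Lemma ex_series_Cmod_qbinom (N : nat) (q t : C) :
  (Cmod q < 1)%R -> (Cmod t < 1)%R ->
  ex_series (fun m => Cmod (qbinom_coef N q m * t ^ m)).
Proof.
  intros Hq Ht. destruct (qbinom_series_dominated N q t Hq) as [K HK].
  apply (ex_series_le (K := R_AbsRing) (V := R_CompleteNormedModule) _
           (fun m => (K * Cmod t ^ m)%R)).
  - intros m. change (Rabs (Cmod (qbinom_coef N q m * t ^ m)) <= K * Cmod t ^ m)%R.
    rewrite Rabs_pos_eq by apply Cmod_ge_0. apply HK.
  - apply ex_series_scal_geom. split; [apply Cmod_ge_0|exact Ht].
Qed.

(* The n-th term is [(c q)^n (b_0 + O(q^n))], so it cannot tend to [0] when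
   [|c q| >= 1] unless [b_0 = 0]. *)
Lemma power_sum_terms_vanish (b s : nat -> C) (q c : C) :
  ex_series (fun m => Cmod (b m)) -> (Cmod q < 1)%R -> (1 <= Cmod (c * q))%R ->
  (forall n, is_Cseries (fun m => (b m * (q ^ S m) ^ n)%C) (s n)) ->
  Cex_series (fun n => (c ^ n * s n)%C) -> b O = 0%C.
Proof.
  intros Hb Hq Hcq Hs Hex. apply is_Cseries_lim_0 in Hex.
  assert (Hb' : ex_series (fun m => Cmod (b (S m)))).
  { exact (proj1 (ex_series_incr_1 (fun m => Cmod (b m))) Hb). }
  set (M := Series (fun m => Cmod (b (S m)))).
  assert (Hpow : forall n, (Cmod (q ^ n) <= 1)%R).
  { intros n. rewrite Cmod_pow, <- (pow1 n). apply pow_incr.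
    split; [apply Cmod_ge_0|lra]. }
  assert (Hle : forall n, (Cmod (b O) <= Cmod (c ^ n * s n) + Cmod q ^ n * M)%R).
  { intros n.
    assert (Hu : Cex_series (fun m => (b m * (q ^ m) ^ n)%C)).
    { apply (Cex_series_Cmod_mult_le _ _ 1 Hb). intros m.
      rewrite <- Cpow_mult_r. apply Hpow. }
    apply CSeries_correct in Hu. set (u := CSeries _) in Hu.
    (* The factor q^n common to all terms is pulled out; what is left, [u], tends to [b O]. *)
    assert (Hsu : s n = (q ^ n * u)%C).
    { rewrite <- (CSeries_unique _ _ (Hs n)). apply CSeries_unique.
      generalize (is_Cseries_scal_l (q ^ n) _ _ Hu). apply is_Cseries_ext.
      intros m. rewrite (Cpow_S q m), Cpow_mult_l. ring. }
    assert (Htail : (Cmod (u - b O) <= Cmod q ^ n * M)%R).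
    { refine (is_Cseries_Cmod_mult_le _ (fun m => ((q ^ S m) ^ n)%C) _ _ Hb' _ _).
      - intros m. rewrite Cpow_S, Cpow_mult_l, Cmod_mult, Cmod_pow, <- Cpow_mult_r.
        rewrite <- (Rmult_1_r (Cmod q ^ n)) at 2.
        apply Rmult_le_compat_l; [apply pow_le, Cmod_ge_0|apply Hpow].
      - generalize (is_Cseries_incr_1 _ _ Hu).
        replace (b O * (q ^ 0) ^ n)%C with (b O); [easy|].
        simpl. rewrite Cpow_1_l. ring. }
    (* c^n s_n = (c q)^n u, and |c q| >= 1. *)
    assert (Hun : (Cmod u <= Cmod (c ^ n * s n))%R).
    { rewrite Hsu, Cmult_assoc, <- Cpow_mult_l, Cmod_mult, Cmod_pow.
      rewrite <- (Rmult_1_l (Cmod u)) at 1.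
      apply Rmult_le_compat_r; [apply Cmod_ge_0|now apply pow_R1_Rle]. }
    replace (b O) with (u + - (u - b O))%C by ring.
    eapply Rle_trans; [apply Cmod_triangle|]. rewrite Cmod_opp. lra. }
  apply Cmod_eq_0, Rle_antisym; [|apply Cmod_ge_0].
  apply (is_lim_seq_le _ _ (Cmod (b O)) 0 Hle); [apply is_lim_seq_const|].
  replace (Finite 0) with (Finite (0 + 0 * M)) by (f_equal; ring).
  apply is_lim_seq_plus'; [exact Hex|].
  apply is_lim_seq_mult'; [|apply is_lim_seq_const].
  apply is_lim_seq_geom. rewrite Rabs_pos_eq; [exact Hq|apply Cmod_ge_0].
Qed.

(* For q and t nonzero the left-hand series diverges as soon as |c q| >= 1, while
   the right-hand one converges for every admissible c.  The identity therefore
   means: the two sums are equal wherever the left-hand series converges, which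
   includes the disc |c q| < 1, and the right-hand side is holomorphic in c on
   the whole admissible domain, so that there it is the analytic continuation of
   the left-hand side.  For q = 0 the powers q^(-n) do not exist and exclude no c. *)
Theorem theorem1p8 (N : nat) (q t c : C)
    (HN : (1 <= N)%nat)
    (Hc : forall n : nat, (1 <= n)%nat -> q <> 0%C -> c <> (/ q ^ n)%C)
    (Ht : (Cmod t < 1)%R)
    (Hq : (Cmod q < 1)%R) :
  Cex_series (fun n => rhs_term N q t c (S n)) /\
  (Cex_series (lhs_term N q t c) -> lhs_sum N q t c = rhs_sum N q t c) /\
  ((Cmod (c * q)%C < 1)%R -> Cex_series (lhs_term N q t c)) /\
  @ex_derive C_AbsRing C_NormedModule (rhs_sum N q t) c.
Proof.
  set (a := fun m => (qbinom_coef N q (S m) * t ^ S m)%C).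
  set (w := fun m => (q ^ S m)%C).
  assert (Ha : ex_series (fun m => Cmod (a m))).
  { exact (proj1 (ex_series_incr_1 (fun m => Cmod (qbinom_coef N q m * t ^ m)))
             (ex_series_Cmod_qbinom N q t Hq Ht)). }
  assert (Hw : forall m, (Cmod (w m) <= 1)%R).
  { intros m. apply Rlt_le. exact (Cmod_mult_pow_lt_1 q q m Hq Hq). }
  assert (Hne : forall m, (1 - c * q ^ S m)%C <> 0%C).
  { intros m E. assert (E1 : (c * q ^ S m = 1)%C).
    { replace (c * q ^ S m)%C with (1 - (1 - c * q ^ S m))%C by ring.
      rewrite E. ring. }
    (* For q = 0 the equation c q^(m+1) = 1 reads 0 = 1; otherwise it makes [c] an excluded
       value. *)
    destruct (Ceq_dec q 0) as [H0|H0].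
    - rewrite H0, Cpow_S, Cmult_0_l, Cmult_0_r in E1. now apply C1_nz.
    - apply (Hc (S m)); [lia|exact H0|].
      rewrite <- (Cmult_1_l (/ q ^ S m)), <- E1. field. now apply Cpow_nz. }
  destruct (one_minus_mult_pow_lower_bound q c Hq Hne) as [d [Hd Hlow]].
  (* The equality is stated at every [x], poles included, so that the derivative can be transported
     by [is_derive_ext]. *)
  assert (Hrhs : forall x, rhs_sum N q t x = CSeries (fun m => (a m / (1 - x * w m))%C)).
  { intros x. apply CSeries_ext. intros m. apply rhs_termE. }
  assert (Hlhs : (Cmod (c * q) < 1)%R ->
    is_Cseries (lhs_term N q t c) (rhs_sum N q t c)).
  { intros Hcq. rewrite Hrhs.
    apply (is_Cseries_ext (fun n => (c ^ n * (/ qpoch (t * q ^ n) q N - 1))%C)).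
    { intros n. now rewrite lhs_termE. }
    apply (is_Cseries_geometric_expansion a w _ c (Cmod (c * q)) Ha Hcq).
    - intros m. apply Rle_trans with (Cmod (c * q * q ^ m)).
      { apply Req_le. f_equal. unfold w. rewrite Cpow_S. ring. }
      rewrite Cmod_mult. rewrite <- (Rmult_1_r (Cmod (c * q))) at 2.
      apply Rmult_le_compat_l; [apply Cmod_ge_0|].
      rewrite Cmod_pow, <- (pow1 m). apply pow_incr.
      split; [apply Cmod_ge_0|lra].
    - intros n. now apply qbinom_tail. }
  split; [|split; [|split]].
  - destruct (Cex_series_Cmod_mult_le a (fun m => / (1 - c * w m))%C (/ d) Ha) as [l Hl].
    { intros m. exact (Cmod_inv_le _ d Hd (Hlow m)). }
    exists l. revert Hl. apply is_Cseries_ext. intros m.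
    now rewrite rhs_termE.
  - intros Hex. destruct (Rlt_le_dec (Cmod (c * q)) 1) as [Hcq|Hcq].
    { now apply CSeries_unique, Hlhs. }
    assert (Ha0 : a O = 0%C).
    { apply (power_sum_terms_vanish a (fun n => / qpoch (t * q ^ n) q N - 1)%C q c Ha Hq Hcq).
      - intros n. now apply qbinom_tail.
      - destruct Hex as [l Hl]. exists l. revert Hl. apply is_Cseries_ext.
        intros n. now apply lhs_termE. }
    assert (Ht0 : t = 0%C).
    (* [a O] equals t (1 - q^N)/(1 - q), and N >= 1 makes 1 - q^N nonzero, so [t] can be recovered
       from it. *)
    { assert (HqN : (1 - q ^ N)%C <> 0%C).
      { destruct N as [|N']; [lia|]. apply Cminus_neq_0.
        exact (Cmod_mult_pow_lt_1 q q N' Hq Hq). }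
      pose proof (Cminus_neq_0 q Hq) as Hq1.
      replace t with (a O * (1 - q) / (1 - q ^ N))%C.
      - rewrite Ha0. unfold Cdiv. ring.
      - unfold a, qbinom_coef. simpl. field. now split. }
    (* With t = 0 the terms of both series are all zero. *)
    subst t. apply CSeries_ext. intros n. unfold lhs_term, rhs_term.
    rewrite !qpoch_0_l, Cpow_S. unfold Cdiv.
    replace (1 * / 1 - 1)%C with (RtoC 0) by field. ring.
  - intros Hcq. exists (rhs_sum N q t c). now apply Hlhs.
  - eexists. eapply is_derive_ext; [intros x; symmetry; apply Hrhs|].
    now apply (is_derive_sum_simple_fractions a w c d).
Qed.
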